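(* Let $E$ be an edge of $G$ with initial vertex $V_1$ and terminal vertex $V_2$, where $V_1$ is a periodic point of $f$ with period $m$ and rotation element $w_1^{1/m}$ and $V_2$ is a periodic point of $f$ with period $n$ and rotation element $w_2^{1/n}$ (so $\widetilde f^m(\widetilde V_1)=w_1\widetilde V_1$ and $\widetilde f^n(\widetilde V_2)=w_2\widetilde V_2$), and $E$ belongs to the spanning tree used for the coherent labeling. Let $\widetilde P_1$ and $\widetilde P_2$ be the shortest paths in $\widetilde G$ from $\widetilde V_1$ to $w_1\widetilde V_1$ and from $\widetilde V_2$ to $w_2\widetilde V_2$, respectively. If $E$ belongs to both $w_1$ and $w_2$ and neither $\widetilde P_1$ nor $\widetilde P_2$ begins with $\widetilde E$, then there exist an initial word $\gamma_1$ of $w_1$ and an initial word $\gamma_2$ of $w_2$ such that for any rationals $r$ and $s$ satisfying $0<r<1/m$ and $0<s<1/n$ there exist integers $p,q,p',q'$ with $r=p/q$ and $s=p'/q'$ and periodic points of $f$ in $E$ with rotation elements $(w_1^p\gamma_1)^{1/q}$ and $(w_2^{p'}\gamma_2)^{1/q'}$.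
   Context: $G$ is a finite connected directed graph (multiple edges allowed, no looped edges) with base vertex $x_0$; $\pi=\pi_1(G,x_0)$, a free group; $\widetilde G$ is the universal cover of $G$, a tree. Elements of $\pi$ are identified with covering transformations of $\widetilde G$ (after fixing a lift $\widetilde x_0$ of $x_0$, the lift at $\widetilde x_0$ of a loop in class $\gamma$ ends at $\gamma\widetilde x_0$), and products act by $(\alpha\beta)\widetilde x=\alpha(\beta\widetilde x)$. Coherent labeling: choose a spanning tree $\mathcal T$ of $G$ rooted at $x_0$ and lift it to a tree in $\widetilde G$ through $\widetilde x_0$; this defines the chosen lifts $\widetilde V$ of all vertices and $\widetilde E$ of all edges of $\mathcal T$. For an edge $E\notin\mathcal T$ with initial vertex $V$ and terminal vertex $V'$, $\widetilde E$ is the lift of $E$ starting at $\widetilde V$; it ends at $\theta\widetilde V'$, where $\theta\in\pi$ is the class of the loop formed by $E$ and $\mathcal T$. These $\theta$ are free generators of $\pi$; words, and initial words (possibly empty initial subwords of the reduced word), are with respect to these generators. For $x$ in the interior of an edge $E$, $\widetilde x$ is the point of $\widetilde E$ over $x$; for a vertex, $\widetilde x$ is its chosen lift. The labeling is coherent with $E\in\mathcal T$, so $\widetilde E$ goes from $\widetilde V_1$ to $\widetilde V_2$. $f:G\to G$ is a continuous vertex map (it permutes the vertices of $G$) homotopic to the identity, and $\widetilde f$ is a fixed lift with $\widetilde f(\gamma\widetilde x)=\gamma\widetilde f(\widetilde x)$ for all $\gamma\in\pi$. Rotation element: for $x\in\mathrm{Fix}(f^n)$, let $w\in\pi$ satisfy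 $\widetilde f^n(\widetilde x)=w\widetilde x$; then $\rho(x)=w^{1/n}$. Rational powers are formal, modulo $(w^k)^r=w^{kr}$ for integers $k$ and rationals $r$ (equivalently they lie in the free $\mathbb Q$-group, where $w^{1/n}=v^{1/m}$ iff $w^m=v^n$). A path begins with $\widetilde E$ if its initial edge is $\widetilde E$ or $\widetilde E^{-1}$ (the reversed edge). Belonging: an edge loop in $G$ is cyclically reduced when its first edge is not the reverse of its last edge (and it has no backtracking). Every loop can be contracted onto a cyclically reduced loop by changing the base point to another vertex of the loop and canceling adjacent inverse edges; the result is called a cyclic reduction. An edge $E$ belongs to $\alpha\in\pi$ when every cyclic reduction of $\alpha$ uses $E$ or $E^{-1}$. *)

(* Defs.v *)
From HB Require Import structures.
From mathcomp Require Import all_boot all_order all_algebra.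
From mathcomp Require Import all_classical all_reals topology normedtype.
From Stdlib Require Import Relation_Operators.

Set Implicit Arguments.
Unset Strict Implicit.
Unset Printing Implicit Defensive.

Import Order.TTheory GRing.Theory Num.Theory.
Import numFieldNormedType.Exports.
Local Open Scope classical_set_scope.
Local Open Scope ring_scope.

Record graph := Graph {
  vert : choiceType;
  edge : choiceType;
  src : edge -> vert;
  tgt : edge -> vert }.

Record fingraph := FinGraph {
  fvert : finType;
  fedge : finType;
  fsrc : fedge -> fvert;
  ftgt : fedge -> fvert }.

Definition graph_of_fingraph (G : fingraph) : graph :=
  @Graph (fvert G) (fedge G) (@fsrc G) (@ftgt G).
Coercion graph_of_fingraph : fingraph >-> graph.

Definition loopless (g : graph) : Prop := forall e : edge g, src e != tgt e.

(* [(e, true)] is the edge [e] traversed from [src e] to [tgt e], and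
   [(e, false)] is the reversed edge. *)
Definition dart (g : graph) : choiceType := (edge g * bool)%type.

Section Walks.
Variable g : graph.
Implicit Types (d : dart g) (s t : seq (dart g)) (x : vert g).

Definition dsrc d : vert g := if d.2 then src d.1 else tgt d.1.
Definition dtgt d : vert g := if d.2 then tgt d.1 else src d.1.
Definition dinv d : dart g := (d.1, ~~ d.2).

Fixpoint walk x s : bool :=
  if s is d :: s' then (dsrc d == x) && walk (dtgt d) s' else true.

Definition walk_end x s : vert g := last x (map dtgt s).

Definition walk_inv s : seq (dart g) := rev (map dinv s).

Definition connected_graph : Prop :=
  forall x y : vert g, exists s, walk x s && (walk_end x s == y).

Definition no_backtrack : rel (dart g) := fun d d' => d' != dinv d.
Definition reduced s : bool := sorted no_backtrack s.

(* [cycle] also compares the last edge with the first one *)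
Definition cyclically_reduced s : bool := cycle no_backtrack s.

Definition push d s : seq (dart g) :=
  if s is d' :: s' then if d' == dinv d then s' else d :: s else [:: d].

(* the unique reduced edge path homotopic to [s] relative to its endpoints *)
Definition reduce s : seq (dart g) := foldr push [::] s.

Definition shortest_walk x y s : Prop :=
  [/\ walk x s, walk_end x s = y &
      forall t, walk x t -> walk_end x t = y -> (size s <= size t)%N].

Definition begins_with s (e : edge g) : Prop :=
  exists b s', s = (e, b) :: s'.

Definition uses (e : edge g) s : bool :=
  ((e, true) \in s) || ((e, false) \in s).

(* change of base point along a loop, and cancellation of adjacent inverse
   edges *)
Inductive contract_step : seq (dart g) -> seq (dart g) -> Prop :=
| contract_rot s t : contract_step (s ++ t) (t ++ s)
| contract_cancel s d t : contract_step (s ++ d :: dinv d :: t) (s ++ t).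

Definition cyclic_reduction_of s t : Prop :=
  clos_refl_trans _ contract_step s t /\ cyclically_reduced t.

Lemma dinvK : involutive dinv.
Proof. by case=> e b; rewrite /dinv negbK. Qed.

Lemma dsrc_inv d : dsrc (dinv d) = dtgt d.
Proof. by case: d => e []. Qed.

Lemma dtgt_inv d : dtgt (dinv d) = dsrc d.
Proof. by case: d => e []. Qed.

Lemma walk_end_cat x s t : walk_end x (s ++ t) = walk_end (walk_end x s) t.
Proof. by rewrite /walk_end map_cat last_cat. Qed.

Lemma walk_cat x s t : walk x (s ++ t) = walk x s && walk (walk_end x s) t.
Proof. by elim: s x => [|d s IHs] x //=; rewrite IHs andbA. Qed.

Lemma walk_push x d s : walk x (d :: s) ->
  walk x (push d s) /\ walk_end x (push d s) = walk_end x (d :: s).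
Proof.
case: s => [|d' s] //=; have [->|//] := eqVneq d' (dinv d).
by rewrite /walk_end /= dtgt_inv; case/and3P=> /eqP dx _; rewrite dx.
Qed.

Lemma walk_reduceP x s : walk x s ->
  walk x (reduce s) /\ walk_end x (reduce s) = walk_end x s.
Proof.
elim: s x => [|d s IHs] x //= /andP[/eqP dx /IHs[ws es]].
have wds : walk x (d :: reduce s) by rewrite /= dx eqxx.
have [wp ep] := walk_push wds; split=> //.
by rewrite ep; exact: es.
Qed.

Lemma walk_reduce x s : walk x s -> walk x (reduce s).
Proof. by case/walk_reduceP. Qed.

Lemma walk_end_reduce x s : walk x s -> walk_end x (reduce s) = walk_end x s.
Proof. by case/walk_reduceP. Qed.

Lemma reduced_push d s : reduced s -> reduced (push d s).
Proof.
case: s => [|d' s] //=; case: eqP => [_|/eqP dd'] rs; first exact: path_sorted rs.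
by rewrite /= /no_backtrack dd'.
Qed.

Lemma reduced_reduce s : reduced (reduce s).
Proof. by elim: s => //= d s; apply: reduced_push. Qed.

Lemma reduce_id s : reduced s -> reduce s = s.
Proof.
elim: s => //= d s IHs rs; rewrite IHs; last exact: path_sorted rs.
by case: s rs {IHs} => //= d' s /andP[/negPf ->].
Qed.

Lemma pushK d s : reduced s -> push d (push (dinv d) s) = s.
Proof.
case: s => [|d' s] /=; first by rewrite eqxx.
rewrite dinvK; case: eqP => [->|_] rs /=; last by rewrite eqxx.
by case: s rs => //= d'' s /andP[/negPf ->].
Qed.

Lemma reduce_catr s t : reduce (s ++ reduce t) = reduce (s ++ t).
Proof.
elim: s => [|d s IHs] /=; last by rewrite IHs.
by rewrite reduce_id ?reduced_reduce.
Qed.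

Lemma reduce_push_cat d s t : reduce (push d s ++ t) = push d (reduce (s ++ t)).
Proof.
case: s => [|d' s] //=; case: eqP => [->|_] //.
by rewrite /= pushK ?reduced_reduce.
Qed.

Lemma reduce_catl s t : reduce (reduce s ++ t) = reduce (s ++ t).
Proof. by elim: s => [|d s IHs] //=; rewrite reduce_push_cat IHs. Qed.

Lemma walk_inv_cons d s : walk_inv (d :: s) = rcons (walk_inv s) (dinv d).
Proof. by rewrite /walk_inv /= rev_cons. Qed.

Lemma walk_invK : involutive walk_inv.
Proof. by move=> s; rewrite /walk_inv map_rev revK (mapK dinvK). Qed.

Lemma walk_walk_inv x s : walk x s ->
  walk (walk_end x s) (walk_inv s) /\ walk_end (walk_end x s) (walk_inv s) = x.
Proof.
elim: s x => [|d s IHs] x //= /andP[/eqP dx /IHs[ws es]].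
rewrite walk_inv_cons -cats1 walk_cat walk_end_cat.
rewrite /walk_end /= -/(walk_end _ s) -/(walk_end _ (walk_inv s)) in ws es *.
by rewrite ws es dsrc_inv dtgt_inv eqxx dx.
Qed.

Lemma reduce_walk_inv s : reduce (s ++ walk_inv s) = [::].
Proof.
elim: s => //= d s IHs.
rewrite walk_inv_cons -cats1 catA -reduce_catl IHs /=.
by rewrite eqxx.
Qed.

End Walks.

Section Cover.
Variables (g : graph) (x0 : vert g).
Implicit Types s t : seq (dart g).

(* [pi_1(g, x0)] as its edge path group: a homotopy class of loops is
   represented by its reduced member *)
Definition is_reduced_loop : pred (seq (dart g)) :=
  fun s => [&& walk x0 s, walk_end x0 s == x0 & reduced s].
Definition pi1 : Type := {s | is_reduced_loop s}.
HB.instance Definition _ := Choice.on pi1.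

Lemma loop_class_subproof s :
  walk x0 s && (walk_end x0 s == x0) -> is_reduced_loop (reduce s).
Proof.
case/andP=> ws es; apply/and3P.
by rewrite walk_reduce ?walk_end_reduce ?reduced_reduce.
Qed.

Definition loop_class s (hs : walk x0 s && (walk_end x0 s == x0)) : pi1 :=
  exist is_reduced_loop (reduce s) (loop_class_subproof hs).

Lemma pi1P (a : pi1) : walk x0 (val a) /\ walk_end x0 (val a) = x0.
Proof. by case: a => s /= /and3P[-> /eqP-> _]. Qed.

Lemma pi1_reduced (a : pi1) : reduced (val a).
Proof. by case: a => s /= /and3P[]. Qed.

Lemma pi1_one_subproof :
  walk x0 ([::] : seq (dart g)) && (walk_end x0 ([::] : seq (dart g)) == x0).
Proof. by rewrite /walk_end /=. Qed.

Lemma pi1_mul_subproof (a b : pi1) :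
  walk x0 (val a ++ val b) && (walk_end x0 (val a ++ val b) == x0).
Proof.
have [wa ea] := pi1P a; have [wb eb] := pi1P b.
by rewrite walk_cat walk_end_cat wa ea wb eb /=.
Qed.

Lemma pi1_inv_subproof (a : pi1) :
  walk x0 (walk_inv (val a)) && (walk_end x0 (walk_inv (val a)) == x0).
Proof.
have [wa ea] := pi1P a; have := walk_walk_inv wa; rewrite ea.
by case=> -> ->; rewrite eqxx.
Qed.

Definition pi1_one : pi1 := loop_class pi1_one_subproof.
Definition pi1_mul (a b : pi1) : pi1 := loop_class (pi1_mul_subproof a b).
Definition pi1_inv (a : pi1) : pi1 := loop_class (pi1_inv_subproof a).

Lemma pi1_mulA : associative pi1_mul.
Proof.
by move=> a b c; apply: val_inj; rewrite /= reduce_catr reduce_catl catA.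
Qed.

Lemma pi1_mul1g : left_id pi1_one pi1_mul.
Proof. by move=> a; apply: val_inj; rewrite /= reduce_id ?pi1_reduced. Qed.

Lemma pi1_mulg1 : right_id pi1_one pi1_mul.
Proof.
by move=> a; apply: val_inj; rewrite /= cats0 reduce_id ?pi1_reduced.
Qed.

Lemma pi1_mulVg : left_inverse pi1_one pi1_inv pi1_mul.
Proof.
move=> a; apply: val_inj; rewrite /= reduce_catl.
by rewrite -{2}(walk_invK (val a)) reduce_walk_inv.
Qed.

Lemma pi1_mulgV : right_inverse pi1_one pi1_inv pi1_mul.
Proof. by move=> a; apply: val_inj; rewrite /= reduce_catr reduce_walk_inv. Qed.

HB.instance Definition _ :=
  isGroup.Build pi1 pi1_mulA pi1_mul1g pi1_mulg1 pi1_mulVg pi1_mulgV.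

(* The universal cover: its vertices are the homotopy classes of edge paths
   starting at [x0], each represented by its reduced member, and the lift of
   the edge [e] starting at the class [u], where [u] ends at [src e], is the
   pair [(u, e)].  The lift of [x0] is the class of the constant path. *)
Definition cover_vert : Type :=
  {s : seq (dart g) | walk x0 s && reduced s}.
HB.instance Definition _ := Choice.on cover_vert.

Lemma path_class_subproof s : walk x0 s ->
  walk x0 (reduce s) && reduced (reduce s).
Proof. by move=> ws; rewrite walk_reduce ?reduced_reduce. Qed.

Definition path_class s (hs : walk x0 s) : cover_vert :=
  exist (fun s => walk x0 s && reduced s) (reduce s) (path_class_subproof hs).

Definition proj_vert (u : cover_vert) : vert g := walk_end x0 (val u).

Definition cover_edge : Type :=
  {ue : cover_vert * edge g | proj_vert ue.1 == src ue.2}.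
HB.instance Definition _ := Choice.on cover_edge.

Definition proj_edge (a : cover_edge) : edge g := (val a).2.

Definition cover_src (a : cover_edge) : cover_vert := (val a).1.

Lemma cover_tgt_subproof (a : cover_edge) :
  walk x0 (rcons (val (cover_src a)) (proj_edge a, true)).
Proof.
have /eqP ue := valP a; have /andP[wu _] := valP (cover_src a).
rewrite -cats1 walk_cat wu /= /dsrc /= andbT.
by rewrite -/(proj_vert (cover_src a)) /cover_src ue.
Qed.

Definition cover_tgt (a : cover_edge) : cover_vert :=
  path_class (cover_tgt_subproof a).

Definition ucover : graph := @Graph cover_vert cover_edge cover_src cover_tgt.

Lemma deck_vert_subproof (a : pi1) (u : cover_vert) :
  walk x0 (val a ++ val u).
Proof.
have [wa ea] := pi1P a.
by rewrite walk_cat wa ea /=; case: u => s /= /andP[].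
Qed.

Definition deck_vert (a : pi1) (u : cover_vert) : cover_vert :=
  path_class (deck_vert_subproof a u).

Lemma proj_deck_vert a u : proj_vert (deck_vert a u) = proj_vert u.
Proof.
have [wa ea] := pi1P a; rewrite /proj_vert /= walk_end_reduce.
  by rewrite walk_end_cat ea.
exact: deck_vert_subproof.
Qed.

Lemma deck_edge_subproof (a : pi1) (b : cover_edge) :
  proj_vert (deck_vert a (cover_src b)) == src (proj_edge b).
Proof. by rewrite proj_deck_vert; case: b. Qed.

Definition deck_edge (a : pi1) (b : cover_edge) : cover_edge :=
  exist (fun ue : cover_vert * edge g => proj_vert ue.1 == src ue.2)
    (deck_vert a (cover_src b), proj_edge b) (deck_edge_subproof a b).

(* every loop in the class [a] contracts to [val a] by cancellations alone, so
   it is enough to contract [val a] *)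
Definition belongs (e : edge g) (a : pi1) : Prop :=
  forall c, cyclic_reduction_of (val a) c -> uses e c.

End Cover.

Section Labeling.
Variables (g : graph) (x0 : vert g).

Definition in_edges (T : pred (edge g)) (s : seq (dart g)) : bool :=
  all (fun d => T d.1) s.

Record spanning_tree := SpanningTree {
  tree_edges :> pred (edge g);
  tree_span : forall v, exists s : seq (dart g),
    [&& walk x0 s, walk_end x0 s == v & in_edges tree_edges s];
  tree_acyclic : forall x (s : seq (dart g)),
    walk x s -> walk_end x s = x -> in_edges tree_edges s ->
    cyclically_reduced s -> s = [::] }.

Variable T : spanning_tree.

Definition tree_walk (v : vert g) : seq (dart g) := xchoose (tree_span T v).

Lemma tree_walkP v : walk x0 (tree_walk v) /\ walk_end x0 (tree_walk v) = v.
Proof. by have /and3P[-> /eqP-> _] := xchooseP (tree_span T v). Qed.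

Definition lift_vert (v : vert g) : cover_vert x0 :=
  path_class (tree_walkP v).1.

Lemma lift_edge_subproof (e : edge g) :
  proj_vert (lift_vert (src e)) == src e.
Proof.
have [we ee] := tree_walkP (src e).
by rewrite /proj_vert /= walk_end_reduce // ee.
Qed.

Definition lift_edge (e : edge g) : cover_edge x0 :=
  exist (fun ue : cover_vert x0 * edge g => proj_vert ue.1 == src ue.2)
    (lift_vert (src e), e) (lift_edge_subproof e).

Definition theta_loop (e : edge g) : seq (dart g) :=
  tree_walk (src e) ++ (e, true) :: walk_inv (tree_walk (tgt e)).

Lemma theta_subproof e :
  walk x0 (theta_loop e) && (walk_end x0 (theta_loop e) == x0).
Proof.
have [we ee] := tree_walkP (src e); have [wt et] := tree_walkP (tgt e).
have := walk_walk_inv wt; rewrite et => -[wi ei].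
rewrite /theta_loop walk_cat walk_end_cat we ee /= /dsrc /= eqxx wi /=.
by rewrite /walk_end /= -/(walk_end _ _) /dtgt /= ei.
Qed.

Definition theta (e : edge g) : pi1 x0 := loop_class (theta_subproof e).

(* the generator [theta e] or its inverse, according to the sign of the dart;
   words use only the darts whose edge is outside of the tree *)
Definition letter (d : dart g) : pi1 x0 :=
  if d.2 then theta d.1 else ((theta d.1)^-1)%g.

Definition word_value (s : seq (dart g)) : pi1 x0 :=
  (\prod_(d <- s) letter d)%g.

Definition initial_word (a w : pi1 x0) : Prop :=
  exists s t : seq (dart g),
    [/\ all (fun d => ~~ T d.1) (s ++ t), reduced (s ++ t),
        word_value (s ++ t) = w & word_value s = a].

End Labeling.

Section Realization.
Variable R : realType.

Definition open01 : choiceType := {t : R | (0 < t < 1)%R}.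

Definition realization (g : graph) : Type := (vert g + edge g * open01)%type.
HB.instance Definition _ g := Choice.on (realization g).

Definition vpt (g : graph) (v : vert g) : realization g := inl v.

(* the characteristic map of [e], extended to all of [R] by constants outside
   of the unit interval *)
Definition edge_pt (g : graph) (e : edge g) (t : R) : realization g :=
  match (insub t : option open01) with
  | Some u => inr (e, u)
  | None => inl (if t <= 0 then src e else tgt e)
  end.

Definition closed_edge (g : graph) (e : edge g) : set (realization g) :=
  [set edge_pt e t | t in `[0, 1]].

(* the quotient topology from the disjoint union of the vertices and of one
   copy of the unit interval for each edge *)
Definition realization_open (g : graph) : set_system (realization g) :=
  [set U | forall e : edge g, open (edge_pt e @^-1` U)].

Section Topology.
Variable g : graph.

Lemma realization_openT : @realization_open g setT.
Proof. by move=> e; rewrite preimage_setT; exact: openT. Qed.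

Lemma realization_openI : setI_closed (@realization_open g).
Proof. by move=> A B oA oB e; rewrite preimage_setI; exact: openI. Qed.

Lemma realization_open_bigU (I : Type) (F : I -> set (realization g)) :
  (forall i, realization_open (F i)) -> realization_open (\bigcup_i F i).
Proof.
by move=> oF e; rewrite preimage_bigcup; apply: bigcup_open => i _; exact: oF.
Qed.

HB.instance Definition _ := isOpenTopological.Build (realization g)
  realization_openT realization_openI realization_open_bigU.
End Topology.

Definition realization_map (g h : graph) (fv : vert g -> vert h)
    (fe : edge g -> edge h) (x : realization g) : realization h :=
  match x with
  | inl v => inl (fv v)
  | inr (e, t) => inr (fe e, t)
  end.

Definition vertex_map (g : graph) (f : realization g -> realization g) : Prop :=
  exists sigma : vert g -> vert g,
    bijective sigma /\ forall v, f (vpt v) = vpt (sigma v).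

Definition homotopic (X Y : topologicalType) (f h : X -> Y) : Prop :=
  exists H : X * R -> Y,
    [/\ {within [set: X] `*` `[0, 1], continuous H},
        forall x, H (x, 0) = f x & forall x, H (x, 1) = h x].

Section Rotation.
Variables (g : graph) (x0 : vert g) (T : spanning_tree x0).

Definition cover_proj : realization (ucover x0) -> realization g :=
  @realization_map (ucover x0) g (@proj_vert g x0) (@proj_edge g x0).

Definition deck (a : pi1 x0) : realization (ucover x0) -> realization (ucover x0) :=
  @realization_map (ucover x0) (ucover x0) (deck_vert a) (deck_edge a).

Definition lift_pt : realization g -> realization (ucover x0) :=
  @realization_map g (ucover x0) (lift_vert T) (lift_edge T).

Variables (f : realization g -> realization g)
          (ft : realization (ucover x0) -> realization (ucover x0)).

Definition equivariant_lift : Prop :=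
  [/\ continuous ft, forall y, cover_proj (ft y) = f (cover_proj y) &
      forall a y, ft (deck a y) = deck a (ft y)].

Definition rotates_by (x : realization g) (n : nat) (w : pi1 x0) : Prop :=
  [/\ (0 < n)%N, iter n f x = x & iter n ft (lift_pt x) = deck w (lift_pt x)].

(* [(w, n)], with [0 < n], stands for the formal root [w^(1/n)] *)
Definition root_eq (a b : pi1 x0 * nat) : Prop :=
  (a.1 ^+ b.2 = b.1 ^+ a.2)%g.

(* the rotation element of [x] is [a], compared as formal roots because it may
   be computed with any [n] such that [x] is fixed by [f^n] *)
Definition has_rotation_element (x : realization g) (a : pi1 x0 * nat) : Prop :=
  exists n w, rotates_by x n w /\ root_eq (w, n) a.

End Rotation.
End Realization.

(* Main.v *)
(* The periodic points come from the intermediate value theorem: an arc of the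
   tree whose endpoints lie on either side of an edge covers this edge, and an
   arc parametrized by an edge [e] that covers a translate [w e] has a point of
   [e] that it sends to its own translate by [w].  This is applied to [ft^q] on
   the lift of [E] and to [w = w1^p gamma1].  As [E] belongs to [w1], the axis of
   [w1] crosses some translate [gamma1 E] by an initial word of [w1]; hence
   [w1^p gamma1 E] lies on the geodesic from [V1] to [w1^N V1] as soon as [p] and
   [N - p] are large, where [N = q / m].  This geodesic begins with the same edge
   as [P1], so it leaves [V1] on the side opposite to [E], whereas the one from
   [V1] to [w2^M V2], with [M = q / n], crosses [E] first; hence the edge
   [w1^p gamma1 E] separates [ft^q V1 = w1^N V1] from [ft^q V2 = w2^M V2].  Given
   [r = a / b < 1 / m], a large common multiple of the numerator and of the
   denominator makes [p] and [N - p] large.  The second periodic point is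
   obtained in the same way from the reversed edge. *)

Require Import Defs.
From HB Require Import structures.
From mathcomp Require Import all_boot all_order all_algebra zify ring lra.
From mathcomp Require Import all_classical all_reals topology normedtype.
From Stdlib Require Import Relation_Operators.

Set Implicit Arguments.
Unset Strict Implicit.
Unset Printing Implicit Defensive.

Import Order.TTheory GRing.Theory Num.Theory.
Import numFieldNormedType.Exports.
Local Open Scope classical_set_scope.
Local Open Scope ring_scope.

Lemma prefix_rconsr (T : eqType) (s t : seq T) y :
  prefix s (rcons t y) = (s == rcons t y) || prefix s t.
Proof.
elim: t s => [|z t IHt] [|w s] //.
  by rewrite prefixs0 prefixs1 orbF.
by rewrite rcons_cons !prefix_cons IHt eqseq_cons -andb_orr.
Qed.

(** * Reduced words *)

Section Words.
Variable g : graph.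
Implicit Types (d : dart g) (s t b c k : seq (dart g)) (x : vert g).

Lemma reducedW s t : reduced (s ++ t) -> reduced s /\ reduced t.
Proof.
rewrite /reduced; case: s => // d s.
by rewrite /= cat_path => /andP[-> /path_sorted].
Qed.

(** Since [k] is nonempty, every pair of consecutive darts lies in [s ++ k] or in [k ++ t]. *)
Lemma reduced_glue s k t : k != [::] ->
  reduced (s ++ k) -> reduced (k ++ t) -> reduced (s ++ k ++ t).
Proof.
case: k => // d k _; rewrite /reduced.
case: s => // e s; rewrite cat_cons /= !cat_path /= => /and3P[-> -> _].
by rewrite cat_path.
Qed.

Lemma dinv_neq d : dinv d != d.
Proof. by case: d => e []; apply/eqP => -[]. Qed.

Lemma walk_inv_cat s t : walk_inv (s ++ t) = walk_inv t ++ walk_inv s.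
Proof. by rewrite /walk_inv map_cat rev_cat. Qed.

Lemma size_walk_inv s : size (walk_inv s) = size s.
Proof. by rewrite /walk_inv size_rev size_map. Qed.

Lemma reduced_walk_inv s : reduced s -> reduced (walk_inv s).
Proof.
rewrite /reduced /walk_inv rev_sorted sorted_map; apply: sub_sorted => d e.
by rewrite /= /no_backtrack dinvK eq_sym.
Qed.

Lemma reduce_walk_invl s : reduce (walk_inv s ++ s) = [::].
Proof. by rewrite -{2}(walk_invK s) reduce_walk_inv. Qed.

Lemma reduce_inner s t u : reduce (s ++ reduce t ++ u) = reduce (s ++ t ++ u).
Proof. by rewrite -reduce_catr reduce_catl reduce_catr. Qed.

Lemma walk_inv_reduce s : walk_inv (reduce s) = reduce (walk_inv s).
Proof.
rewrite -[LHS]reduce_id; last exact/reduced_walk_inv/reduced_reduce.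
have <- : reduce (walk_inv (reduce s) ++ s ++ walk_inv s) =
    reduce (walk_inv (reduce s)).
  by rewrite -reduce_catr reduce_walk_inv cats0.
by rewrite -reduce_inner catA -reduce_catl reduce_walk_invl.
Qed.

Lemma mem_reduce s : {subset reduce s <= s}.
Proof.
elim: s => //= d s IHs e; rewrite /push inE.
case: (reduce s) IHs => [|d' u] IHs; first by rewrite inE => ->.
case: eqP => _ eu; first by rewrite IHs ?orbT // inE eu orbT.
by move: eu; rewrite inE => /orP[->//|/IHs->]; rewrite orbT.
Qed.

Lemma size_reduce s : (size (reduce s) <= size s)%N.
Proof.
elim: s => //= d s; rewrite /push; case: (reduce s) => //= d' u us.
by case: eqP => //= _; apply: leq_trans (leqnSn _); apply: ltnW.
Qed.

Lemma size_reduce_id s : (size s <= size (reduce s))%N -> reduce s = s.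
Proof.
elim: s => //= d s IHs; rewrite /push; have := size_reduce s.
case: (reduce s) IHs => [|d' u] IHs /= us.
  by rewrite ltnS leqn0 => /nilP ->.
case: eqP => _ su; last by rewrite IHs.
by move: (leq_trans us (ltnW su)); rewrite ltnn.
Qed.

(** Two reduced paths cancel only at their junction; [c] is the end of [s] that disappears. *)
Lemma reduce_cat_split s t : reduced s -> reduced t ->
  exists u c v, [/\ s = u ++ c, t = walk_inv c ++ v & reduce (s ++ t) = u ++ v].
Proof.
elim/last_ind: s t => [|s d IHs] t rs rt.
  by exists [::], [::], t; rewrite /= reduce_id.
case: t rt => [|d' t] rt.
  by exists (rcons s d), [::], [::]; rewrite !cats0 reduce_id.
have [d'd|d'd] := eqVneq d' (dinv d); last first.
  exists (rcons s d), [::], (d' :: t); rewrite cats0; split=> //.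
  rewrite reduce_id // -cats1 -catA; apply: reduced_glue => //.
    by rewrite cats1.
  by rewrite /reduced /= /no_backtrack d'd.
have rs' : reduced s by move: rs; rewrite -cats1 => /reducedW[].
have rt' : reduced t by move: rt; rewrite -cat1s => /reducedW[].
have [u [c [v [sE tE rE]]]] := IHs t rs' rt'.
exists u, (rcons c d), v; split.
- by rewrite sE rcons_cat.
- by rewrite d'd tE /walk_inv map_rcons rev_rcons.
rewrite -rE d'd -cats1 -catA -reduce_catr /=.
by rewrite pushK ?reduced_reduce // reduce_catr.
Qed.

(** Stripping mutually inverse first and last darts, one pair at a time, leaves the core [k]. *)
Lemma cyclic_decomposition c : reduced c ->
  exists b k, c = b ++ k ++ walk_inv b /\ cyclically_reduced k.
Proof.
have [n] := ubnP (size c); elim: n c => // n IHn [|d c].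
  by exists [::], [::].
rewrite ltnS [size _]/=; case/lastP: c => [|c e].
  by move=> _ _; exists [::], [:: d]; rewrite /cyclically_reduced /= andbT
    /no_backtrack eq_sym dinv_neq.
rewrite size_rcons => cn rc.
have [ed|ed] := eqVneq e (dinv d).
  have rc' : reduced c.
    by move: rc; rewrite -cats1 -(cat1s d) => /reducedW[_] /reducedW[].
  have [b [k [-> ck]]] := IHn _ (ltnW cn) rc'.
  exists (d :: b), k; split=> //.
  by rewrite walk_inv_cons ed -!cats1 /= -!catA.
exists [::], (d :: rcons c e); rewrite cats0; split=> //.
rewrite /cyclically_reduced /= rcons_path last_rcons.
move: rc; rewrite /reduced /= => -> /=; rewrite /no_backtrack.
by apply: contraNneq ed => ->; rewrite dinvK.
Qed.

Definition seq_pow n s : seq (dart g) := flatten (nseq n s).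

Lemma seq_powS n s : seq_pow n.+1 s = s ++ seq_pow n s.
Proof. by []. Qed.

Lemma size_seq_pow n s : size (seq_pow n s) = (n * size s)%N.
Proof. by elim: n => //= n IHn; rewrite size_cat IHn mulSn. Qed.

(** Cyclic reducedness prevents cancellation between successive copies of [k]; the outer junctions
    already occur in [b ++ k ++ walk_inv b]. *)
Lemma reduced_conj_pow n b k : k != [::] -> cyclically_reduced k ->
  reduced (b ++ k ++ walk_inv b) -> reduced (b ++ seq_pow n.+1 k ++ walk_inv b).
Proof.
move=> k0 ck rc; have rkb : reduced (k ++ walk_inv b) by case/reducedW: rc.
have rbk : reduced (b ++ k) by move: rc; rewrite catA => /reducedW[].
have rkk : reduced (k ++ k).
  case: k k0 ck {rc rbk rkb} => // d k _.
  rewrite /cyclically_reduced /reduced /= rcons_path cat_path /=.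
  by case/andP=> -> ->.
suff: reduced (seq_pow n.+1 k ++ walk_inv b).
  by rewrite seq_powS -!catA; apply: reduced_glue.
elim: n => [|n IHn]; first by rewrite /seq_pow /= cats0.
rewrite seq_powS -catA seq_powS -catA; apply: reduced_glue => //.
by rewrite catA.
Qed.

Lemma reduce_conj_pow n b k :
  reduce (seq_pow n.+1 (b ++ k ++ walk_inv b)) =
  reduce (b ++ seq_pow n.+1 k ++ walk_inv b).
Proof.
elim: n => [|n IHn]; first by rewrite /seq_pow /= !cats0.
rewrite seq_powS -reduce_catr IHn reduce_catr.
have := reduce_inner (b ++ k) (walk_inv b ++ b) (seq_pow n.+1 k ++ walk_inv b).
by rewrite reduce_walk_invl [seq_pow n.+2 k]seq_powS -!catA.
Qed.

(** The reduced power is [b], copies of the core, then [walk_inv b], so it starts as [c] does. This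
    carries the condition on the first edge of a shortest path over to powers of the deck
    transformation. *)
Lemma ohead_reduce_pow n c : reduced c ->
  ohead (reduce (seq_pow n.+1 c)) = ohead c.
Proof.
move=> rc; have [b [k [cE ck]]] := cyclic_decomposition rc.
have [k0|k0] := eqVneq k [::].
  have : c = [::].
    by rewrite -(reduce_id rc) cE k0 reduce_walk_inv.
  by move=> ->; elim: n => //= n; rewrite /seq_pow.
rewrite cE reduce_conj_pow reduce_id; last first.
  by apply: reduced_conj_pow; rewrite // -cE.
by case: b {cE} => //; case: k k0 {ck}.
Qed.

(** A rotation brings [walk_inv b] next to [b], and the two cancel from the middle outwards. Hence
    the core of a loop is one of its cyclic reductions. *)
Lemma contract_conj b k :
  clos_refl_trans _ (@contract_step g) (b ++ k ++ walk_inv b) k.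
Proof.
apply: (rt_trans _ _ _ (k ++ walk_inv b ++ b)).
  by apply: rt_step; rewrite (catA k); exact: contract_rot.
elim: b => [|d b IHb]; first by rewrite /walk_inv /= cats0; exact: rt_refl.
apply: rt_trans IHb; apply: rt_step.
have := contract_cancel (k ++ walk_inv b) (dinv d) b.
by rewrite dinvK walk_inv_cons -cats1 -!catA.
Qed.

End Words.

(** * The tree of reduced paths *)

Section Cover.
Variables (g : graph) (x0 : vert g).
Implicit Types (u v z : cover_vert x0) (a : cover_edge x0) (w : pi1 x0).

Lemma reduce_rcons (s : seq (dart g)) d : reduced s ->
  reduce (rcons s d) = rcons s d \/ s = rcons (reduce (rcons s d)) (dinv d).
Proof.
case/lastP: s => [|s e] rs; first by left.
have [->|ed] := eqVneq e (dinv d).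
  have rs' : reduced s by move: rs; rewrite -cats1 => /reducedW[].
  right; congr rcons; rewrite -!cats1 -catA -reduce_catr /= dinvK eqxx cats0.
  by rewrite reduce_id.
left; rewrite reduce_id // -cats1 -cats1 -catA; apply: reduced_glue => //.
  by rewrite cats1.
rewrite /reduced /= /no_backtrack andbT; apply: contraNneq ed => ->.
by rewrite dinvK.
Qed.

Lemma reduced_cover u : reduced (val u).
Proof. by case: u => s /= /andP[]. Qed.

Lemma walk_cover u : walk x0 (val u).
Proof. by case: u => s /= /andP[]. Qed.

(** The shortest path of the cover from [u] to [v], recorded by its projection to [g]; in this form
    deck transformations leave it unchanged. *)
Definition geodesic u v := reduce (walk_inv (val u) ++ val v).

Lemma reduced_geodesic u v : reduced (geodesic u v).
Proof. exact: reduced_reduce. Qed.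

Lemma geodesic_id u : geodesic u u = [::].
Proof. exact: reduce_walk_invl. Qed.

Lemma geodesic_cat u z v : reduce (geodesic u z ++ geodesic z v) = geodesic u v.
Proof.
rewrite reduce_catl reduce_catr -!catA (catA (val z)) -reduce_inner.
by rewrite reduce_walk_inv.
Qed.

Lemma val_geodesic u v : reduce (val u ++ geodesic u v) = val v.
Proof.
by rewrite reduce_catr catA -reduce_catl reduce_walk_inv reduce_id ?reduced_cover.
Qed.

Lemma geodesic_inj u : injective (geodesic u).
Proof.
by move=> v v' e; apply: val_inj; rewrite -(val_geodesic u v) e val_geodesic.
Qed.

Lemma geodesic_deck w u v :
  geodesic (deck_vert w u) (deck_vert w v) = geodesic u v.
Proof.
rewrite /geodesic /= walk_inv_reduce reduce_catl reduce_catr walk_inv_cat.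
rewrite -catA (catA (walk_inv (val w))) -reduce_inner reduce_walk_invl.
by [].
Qed.

Lemma deck_vertM w w' u : deck_vert (w * w')%g u = deck_vert w (deck_vert w' u).
Proof. by apply: val_inj; rewrite /= reduce_catl reduce_catr catA. Qed.

Lemma deck_vert1 u : deck_vert 1%g u = u.
Proof. by apply: val_inj; rewrite /= reduce_id ?reduced_cover. Qed.

Lemma cover_tgt_deck w a : cover_tgt (deck_edge w a) = deck_vert w (cover_tgt a).
Proof.
apply: val_inj; rewrite /= -!cats1 reduce_catl reduce_catr catA.
by [].
Qed.

Lemma geodesic_tgt u a : geodesic u (cover_tgt a) =
  reduce (rcons (geodesic u (cover_src a)) (proj_edge a, true)).
Proof. by rewrite -cats1 reduce_catl /geodesic /= -cats1 reduce_catr catA. Qed.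

Lemma cover_edge_inj a a' : cover_src a = cover_src a' ->
  proj_edge a = proj_edge a' -> a = a'.
Proof.
move=> es ep; apply: val_inj; move: es ep; rewrite /cover_src /proj_edge.
by case: (val a) => ? ?; case: (val a') => ? ? /= -> ->.
Qed.

(* The geodesic from [u] to the endpoint of [a] that is farther from [u]; it is
   a prefix of the geodesic from [u] to [v] iff [a] separates [u] from [v]. *)
Definition far u a : seq (dart g) :=
  let s := geodesic u (cover_src a) in let t := geodesic u (cover_tgt a) in
  if (size s < size t)%N then t else s.

Lemma farP u a : exists b,
  far u a = rcons (geodesic u (@dsrc (ucover x0) (a, b))) (proj_edge a, b) /\
  far u a = geodesic u (@dtgt (ucover x0) (a, b)).
Proof.
rewrite /far /dsrc /dtgt /=.
case: (reduce_rcons (proj_edge a, true) (reduced_geodesic u (cover_src a)));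
  rewrite -geodesic_tgt => e.
  by exists true; rewrite {1 3}e size_rcons ltnSn /= e.
exists false; have -> : (size (geodesic u (cover_src a)) <
    size (geodesic u (cover_tgt a)))%N = false.
  by rewrite e size_rcons ltnNge leqnSn.
by split.
Qed.

(** The last dart gives the projected edge and its direction; the path with and without this dart
    determines both endpoints in the cover. *)
Lemma far_inj u : injective (far u).
Proof.
move=> a a'; have [b [-> e]] := farP u a; have [b' [-> e']] := farP u a'.
move=> /[dup] ef /rcons_inj [es ep eb]; subst b'; rewrite ef e' in e.
apply: cover_edge_inj => //; apply: (@geodesic_inj u).
by case: b es e {e' ef}.
Qed.

Definition side u a v := prefix (far u a) (geodesic u v).

Lemma side_id u a : side u a u = false.
Proof.
by have [b [e _]] := farP u a; rewrite /side e geodesic_id; case: geodesic.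
Qed.

(** The geodesic to the farther end of [a'] gains a single prefix, [far u a'] itself, and [far] is
    injective; so only the side with respect to [a'] changes. *)
Lemma side_edge u a a' :
  side u a (cover_tgt a') = side u a (cover_src a') (+) (a == a').
Proof.
have [b [e e']] := farP u a'.
have: side u a (@dtgt (ucover x0) (a', b)) =
    side u a (@dsrc (ucover x0) (a', b)) (+) (a == a').
  rewrite /side -e' e prefix_rconsr -e (inj_eq (@far_inj u)).
  have [->|_] := eqVneq a a'; last by rewrite addbF.
  rewrite orTb e addbT; apply/esym/negP => /size_prefix.
  by rewrite size_rcons ltnn.
by case: b {e e'} => //= ->; rewrite addbK.
Qed.

Definition proj_dart (d : dart (ucover x0)) : dart g := (proj_edge d.1, d.2).

Lemma val_dtgt (d : dart (ucover x0)) :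
  val (@dtgt (ucover x0) d : cover_vert x0) =
  reduce (rcons (val (@dsrc (ucover x0) d : cover_vert x0)) (proj_dart d)).
Proof.
case: d => a [] //; rewrite /dtgt /dsrc /proj_dart /= -!cats1 reduce_catl.
by rewrite -catA -reduce_catr /= eqxx cats0 reduce_id // reduced_cover.
Qed.

Lemma proj_dsrc d : proj_vert (@dsrc (ucover x0) d) = dsrc (proj_dart d).
Proof.
case: d => a [] /=; rewrite /dsrc /=; first exact/eqP/(valP a).
rewrite /proj_vert /= walk_end_reduce; last exact: (cover_tgt_subproof a).
by rewrite -cats1 walk_end_cat.
Qed.

Lemma lift_dart u (d : dart g) : dsrc d = proj_vert u ->
  exists d', @dsrc (ucover x0) d' = u /\ proj_dart d' = d.
Proof.
case: d => e [] /= du.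
  have h : proj_vert (u, e).1 == src (u, e).2 by rewrite -du.
  by exists (exist _ (u, e) h, true).
(* The lift of a reversed edge ends at the source of the lifted edge, so this source is found by
   traversing the dart from [u]. *)
have wv : walk x0 (rcons (val u) (e, false)).
  by rewrite -cats1 walk_cat walk_cover /= du eqxx.
have h : proj_vert (path_class wv, e).1 == src (path_class wv, e).2.
  by rewrite /proj_vert /= walk_end_reduce // -cats1 walk_end_cat.
exists (exist _ (path_class wv, e) h, false); split=> //.
apply: val_inj; rewrite /= -cats1 reduce_catl cat_rcons -reduce_catr /=.
by rewrite eqxx cats0 reduce_id //; exact: reduced_cover.
Qed.

Definition cover_base : cover_vert x0 :=
  path_class (isT : walk x0 ([::] : seq (dart g))).

(** Connectedness of the cover as an induction principle: dropping the last dart of the reduced path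
    repeatedly joins any vertex to the base. *)
Lemma cover_ind (P : cover_vert x0 -> Prop) u :
  P u -> (forall a, P (cover_src a) <-> P (cover_tgt a)) -> forall v, P v.
Proof.
move=> Pu Pe; suff H v : P v <-> P cover_base.
  by move=> v; apply/H/(H u).
have [n] := ubnP (size (val v)); elim: n v => // n IHn v.
case/lastP E : (val v) => [|s d].
  by move=> _; suff -> : v = cover_base by []; apply: val_inj; rewrite E.
rewrite size_rcons ltnS => sn.
have [rs ws] : reduced s /\ walk x0 (rcons s d).
  split; last by rewrite -E walk_cover.
  by have := reduced_cover v; rewrite E -cats1 => /reducedW[].
have ws' := ws; move: ws'; rewrite -cats1 walk_cat => /and3P[ws' /eqP ds _].
pose z := path_class ws'; have zE : val z = s by rewrite /= reduce_id.
have [|d' [dz dd]] := @lift_dart z d; first by rewrite ds /proj_vert zE.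
have dv : @dtgt (ucover x0) d' = v.
  apply: val_inj; rewrite val_dtgt dz dd zE -E reduce_id ?reduced_cover //.
rewrite -(IHn z) ?zE // -dz -dv; case: d' {dz dd dv} => a [] /=.
  by rewrite /dtgt /dsrc /= Pe.
by rewrite /dtgt /dsrc /= Pe.
Qed.

(** Seen from [z] or from [u], the side of [v] flips exactly when [v] crosses [a], and both members
    vanish at [v = z]. This allows a change of viewpoint. *)
Lemma side_cocycle u z a v : side z a v = side u a v (+) side u a z.
Proof.
move: v; apply: (@cover_ind _ z); first by rewrite side_id addbb.
move=> b; rewrite !side_edge addbAC; split=> [->//|/(can_inj (addbK _))].
by [].
Qed.

Lemma side_deck w u a v :
  side (deck_vert w u) (deck_edge w a) (deck_vert w v) = side u a v.
Proof. by rewrite /side /far cover_tgt_deck !geodesic_deck. Qed.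

Lemma walk_proj u (P : seq (dart (ucover x0))) : @walk (ucover x0) u P ->
  val (@walk_end (ucover x0) u P : cover_vert x0) =
  reduce (val u ++ map proj_dart P).
Proof.
elim: P u => [|d P IHP] u /=; first by rewrite cats0 reduce_id // reduced_cover.
case/andP=> /eqP <- /IHP.
by rewrite /walk_end /= => ->; rewrite val_dtgt reduce_catl cat_rcons.
Qed.

Lemma lift_walk u (s : seq (dart g)) : walk (proj_vert u) s ->
  exists2 P, @walk (ucover x0) u P & map proj_dart P = s.
Proof.
elim: s u => [|d s IHs] u /=; first by exists [::].
case/andP=> /eqP du; have [d' [dz dd]] := lift_dart du; rewrite -dd.
have -> : dtgt (proj_dart d') = proj_vert (@dtgt (ucover x0) d').
  have := proj_dsrc (@dinv (ucover x0) d').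
  rewrite dsrc_inv => ->; have -> : proj_dart (dinv d') = dinv (proj_dart d') by [].
  by rewrite dsrc_inv.
by case/IHs => P wP <-; exists (d' :: P); rewrite //= dz eqxx.
Qed.

Lemma walk_geodesic u v : walk (proj_vert u) (geodesic u v).
Proof.
have [wu eu] := walk_walk_inv (walk_cover u).
apply: walk_reduce; rewrite walk_cat -/(proj_vert u) in wu eu *.
by rewrite wu eu walk_cover.
Qed.

(** The geodesic lifts to a walk with the same ends, so minimality of [P] leaves no room for
    cancellation in its projection. *)
Lemma shortest_walk_proj u v P : @shortest_walk (ucover x0) u v P ->
  map proj_dart P = geodesic u v.
Proof.
case=> wP eP minP; have := walk_proj wP; rewrite eP => vE.
have gE : geodesic u v = reduce (map proj_dart P).
  rewrite /geodesic vE reduce_catr catA -reduce_catl reduce_walk_invl.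
  by [].
rewrite gE size_reduce_id //; have [Q wQ QE] := lift_walk (walk_geodesic u v).
rewrite -gE -QE !size_map; apply: minP => //.
by apply: val_inj; rewrite walk_proj // QE val_geodesic.
Qed.

End Cover.

(** * Initial words and axes *)

Section Labels.
Variables (g : graph) (x0 : vert g) (T : spanning_tree x0).
Implicit Types (u v : cover_vert x0) (w : pi1 x0) (d : dart g).
Implicit Types (s t b k : seq (dart g)).

(** The core of the reduced walk is a cyclically reduced closed walk in the tree, hence empty by
    acyclicity. *)
Lemma tree_closed x s : walk x s -> walk_end x s = x -> in_edges T s ->
  reduce s = [::].
Proof.
move=> ws es Ts; have [wr er] := walk_reduceP ws.
have Tr : in_edges T (reduce s).
  by apply/allP => d /mem_reduce; exact: (allP Ts).
have [b [k [rE ck]]] := cyclic_decomposition (reduced_reduce s).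
have k0 : k = [::].
  move: wr er Tr; rewrite es rE /in_edges !all_cat walk_cat !walk_end_cat.
  rewrite walk_cat => /and3P[wb wk wbi] ebi /and3P[_ Tk _].
  have [_] := walk_walk_inv wbi; rewrite walk_invK ebi => ek.
  exact: tree_acyclic wk (esym ek) Tk ck.
by have:= reduce_id (reduced_reduce s); rewrite rE k0 reduce_walk_inv.
Qed.

Lemma in_edges_walk_inv s : in_edges T (walk_inv s) = in_edges T s.
Proof. by rewrite /in_edges all_rev all_map. Qed.

Lemma tree_walk_in (v : vert g) : in_edges T (tree_walk T v).
Proof. by have /and3P[] := xchooseP (tree_span T v). Qed.

Lemma tree_walk_dart d : T d.1 ->
  reduce (tree_walk T (dsrc d) ++ d :: walk_inv (tree_walk T (dtgt d))) = [::].
Proof.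
move=> Td; have [w1 e1] := tree_walkP T (dsrc d).
have [w2 e2] := tree_walkP T (dtgt d).
have := walk_walk_inv w2; rewrite e2 => -[wi ei].
apply: (@tree_closed x0).
- by rewrite walk_cat w1 e1 /= eqxx wi.
- by rewrite walk_end_cat e1 -cat1s walk_end_cat.
rewrite /in_edges all_cat -/(in_edges T _) tree_walk_in /= Td.
by rewrite -/(in_edges T _) in_edges_walk_inv tree_walk_in.
Qed.

Lemma val_letter d : val (letter T d) =
  reduce (tree_walk T (dsrc d) ++ d :: walk_inv (tree_walk T (dtgt d))).
Proof.
case: d => e [] //=; rewrite /letter /= walk_inv_reduce.
rewrite reduce_id ?reduced_reduce //.
rewrite /theta_loop walk_inv_cat walk_inv_cons walk_invK.
by rewrite cat_rcons.
Qed.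

Lemma letter_tree d : T d.1 -> letter T d = 1%g.
Proof. by move=> Td; apply: val_inj; rewrite val_letter tree_walk_dart. Qed.

(** The product telescopes: the tree walk that ends one letter cancels the tree walk that starts the
    next. *)
Lemma val_word_value x s : walk x s -> val (word_value T s) =
  reduce (tree_walk T x ++ s ++ walk_inv (tree_walk T (walk_end x s))).
Proof.
rewrite /word_value; elim: s x => [|d s IHs] x /=.
  by move=> _; rewrite big_nil reduce_walk_inv.
case/andP=> /eqP <- /IHs IH; rewrite big_cons /= val_letter IH -/(walk_end _ s).
rewrite reduce_catl reduce_catr -(cat1s d).
set t := tree_walk T (dtgt d); set e := walk_inv (tree_walk T (walk_end _ s)).
have := reduce_inner (tree_walk T (dsrc d) ++ [:: d]) (walk_inv t ++ t) (s ++ e).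
by rewrite reduce_walk_invl -!catA /= => ->.
Qed.

(** The chosen walk to [x0] may be nonempty, but it is closed and stays in the tree. *)
Lemma tree_walk_base : reduce (tree_walk T x0) = [::].
Proof.
by have [w0 e0] := tree_walkP T x0; exact: tree_closed w0 e0 (tree_walk_in x0).
Qed.

Lemma word_value_filter s :
  word_value T [seq d <- s | ~~ T d.1] = word_value T s.
Proof.
rewrite /word_value; elim: s => //= d s IHs; rewrite [RHS]big_cons -IHs.
case: ifP => [_|/negbFE Td]; first by rewrite big_cons.
by rewrite letter_tree // mul1g.
Qed.

Lemma filter_tree s : [seq d <- s | ~~ T d.1] = [::] -> in_edges T s.
Proof.
by elim: s => //= d s IHs; case: ifP => // /negbFE -> /IHs.
Qed.

(** If two kept darts became adjacent and inverse, the tree walk removed between them would be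
    closed and reduced, hence empty, and [s] would already backtrack. *)
Lemma reduced_filter x s : walk x s -> reduced s ->
  reduced [seq d <- s | ~~ T d.1].
Proof.
elim: s x => //= d s IHs x /andP[_ ws] rs.
have {}IHs := IHs _ ws (path_sorted rs).
case: ifP => // _; case E : (seq.filter _ s) IHs => [|d' v] // IHs.
rewrite /reduced /=; apply/andP; split=> //; apply/eqP => dd.
have [s1 [s2 [sE s1E]]] : exists s1 s2, s = s1 ++ d' :: s2 /\
    [seq d <- s1 | ~~ T d.1] = [::].
  elim: s E {IHs ws rs} => //= e s IHs; case: ifP => Te.
    by case=> -> _; exists [::], s.
  by move/IHs => [s1 [s2 [-> s1E]]]; exists (e :: s1), s2; rewrite /= Te s1E.
have s10 : s1 = [::].
  rewrite -(@reduce_id _ s1); last first.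
    by move: (path_sorted rs); rewrite sE => /reducedW[].
  move: ws; rewrite sE walk_cat => /and3P[w1 /eqP e1 _].
  apply: (tree_closed w1); last exact: filter_tree.
  by rewrite -e1 dd dsrc_inv.
by move: rs; rewrite sE s10 /= /no_backtrack dd eqxx.
Qed.

Lemma word_value_val w : word_value T (val w) = w.
Proof.
have [ww ew] := pi1P w; apply: val_inj; rewrite (val_word_value ww) ew.
rewrite -reduce_catl tree_walk_base /= -reduce_catr -walk_inv_reduce.
rewrite tree_walk_base cats0.
by rewrite reduce_id ?pi1_reduced.
Qed.

(* The letters of the word of [w] are read off from the edges outside of [T]
   crossed by the loop [val w], so that the lifts of vertices crossed by this
   loop are the translates of the chosen ones by the initial words of [w]. *)
Lemma initial_word_prefix w s t : val w = s ++ t ->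
  exists2 gamma, initial_word T gamma w &
    val (deck_vert gamma (lift_vert T (walk_end x0 s))) = s.
Proof.
move=> wE; exists (word_value T s).
  exists [seq d <- s | ~~ T d.1], [seq d <- t | ~~ T d.1].
  have [ww _] := pi1P w; have rw := pi1_reduced w.
  rewrite -filter_cat -wE filter_all (reduced_filter ww rw) !word_value_filter.
  by rewrite word_value_val.
have [ww _] := pi1P w; have rw := pi1_reduced w.
move: ww rw; rewrite wE walk_cat => /andP[ws _] /reducedW[rs _].
rewrite /= (val_word_value ws) reduce_catl reduce_catr.
set tw := tree_walk T (walk_end x0 s).
rewrite -!catA -reduce_catl tree_walk_base /=.
by rewrite -reduce_catr reduce_walk_invl cats0 reduce_id.
Qed.

(** Inserting the trivial loop of the tree dart [d] between the two tree walks makes them cancel and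
    leaves [d] alone. *)
Lemma geodesic_lift_vert d : T d.1 ->
  geodesic (lift_vert T (dsrc d)) (lift_vert T (dtgt d)) = [:: d].
Proof.
move=> Td; rewrite /geodesic /= walk_inv_reduce reduce_catl reduce_catr.
set a := tree_walk T _; set b := tree_walk T _.
have := reduce_inner (walk_inv a) (a ++ d :: walk_inv b) b.
rewrite (tree_walk_dart Td) /= => ->; rewrite -!catA cat_cons catA.
rewrite -reduce_catl reduce_walk_invl /= reduce_walk_invl.
by [].
Qed.

Lemma cover_tgt_lift_edge (e : edge g) : T e ->
  cover_tgt (lift_edge T e) = lift_vert T (tgt e).
Proof.
move=> Te; have Td : T (e, true).1 by [].
apply: (@geodesic_inj _ _ (lift_vert T (src e))).
by rewrite (geodesic_lift_vert Td) geodesic_tgt geodesic_id.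
Qed.

Lemma dsrc_lift_edge (e : edge g) (b : bool) : T e ->
  @dsrc (ucover x0) (lift_edge T e, b) = lift_vert T (dsrc (e, b)).
Proof. by move=> Te; case: b; rewrite /dsrc /= ?cover_tgt_lift_edge. Qed.

Lemma dsrc_deck w a (b : bool) :
  @dsrc (ucover x0) (deck_edge w a, b) =
  deck_vert w (@dsrc (ucover x0) (a, b)).
Proof. by case: b; rewrite /dsrc /= ?cover_tgt_deck. Qed.

Lemma val_exp w j : val (w ^+ j)%g = reduce (seq_pow j (val w)).
Proof.
elim: j => // j IHj; rewrite expgS /= IHj reduce_catr.
by [].
Qed.

Lemma prefix_reduce_cat s t b : reduced s -> reduced t -> prefix b s ->
  (size b + size t <= size s)%N -> prefix b (reduce (s ++ t)).
Proof.
move=> rs rt; case: (reduce_cat_split rs rt) => u [c [v [-> -> ->]]] {rs rt}.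
rewrite !size_cat size_walk_inv => bs sz; apply: prefix_catl.
move: bs; rewrite !prefixE takel_cat //.
by rewrite -(leq_add2r (size c)); apply: leq_trans sz; rewrite leq_add2l leq_addr.
Qed.

(** The reduced power reads [b], [j] copies of [k], [walk_inv b]. Appending [val u] cancels fewer
    than [j] darts, so the first copy of [k] survives. *)
Lemma prefix_deck_exp w u b k j : val w = b ++ k ++ walk_inv b ->
  k != [::] -> cyclically_reduced k -> (size (val u) < j)%N ->
  prefix (b ++ k) (val (deck_vert (w ^+ j)%g u)).
Proof.
move=> wE k0 ck; case: j => // j uj.
have rw : reduced (b ++ k ++ walk_inv b) by rewrite -wE pi1_reduced.
have rj := reduced_conj_pow j k0 ck rw.
rewrite [val _]/= -/(val (w ^+ j.+1)%g) -/(val u) val_exp wE reduce_conj_pow.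
rewrite reduce_catl; apply: prefix_reduce_cat => //; first exact: reduced_cover.
  by rewrite seq_powS -!catA catA prefix_prefix.
have : (0 < size k)%N by case: (k) k0.
rewrite !size_cat size_seq_pow size_walk_inv; move: uj.
set x := size (val u); set y := size k; set z := size b; nia.
Qed.

Lemma cyclically_reduced_inv k : cyclically_reduced k ->
  cyclically_reduced (walk_inv k).
Proof.
rewrite /cyclically_reduced /walk_inv rev_cycle cycle_map.
apply: sub_cycle => d e.
by rewrite /= /no_backtrack dinvK eq_sym.
Qed.

(** The inverse of [k] starts with the inverse of the last dart of [k], so the axis leaves in two
    different directions. *)
Lemma cyclically_reduced_ends k d : cyclically_reduced k ->
  ohead k = Some d -> ohead (walk_inv k) <> Some d.
Proof.
case: k => // e k; case/lastP: k => [|k c].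
  by move=> _ [->] [] /eqP; rewrite (negPf (dinv_neq d)).
rewrite /cyclically_reduced [cycle _ _]/= rcons_path last_rcons => /andP[_].
move=> /eqP cd [<-]; rewrite /walk_inv /= map_rcons rev_cons rev_rcons /=.
by case=> dc; apply: cd.
Qed.

Lemma geodesic_base u : geodesic (cover_base x0) u = val u.
Proof. by rewrite /geodesic /= reduce_id // reduced_cover. Qed.

Lemma far_base_dart (d : dart (ucover x0)) s :
  val (@dsrc (ucover x0) d : cover_vert x0) = s ->
  reduced (rcons s (proj_dart d)) ->
  far (cover_base x0) d.1 = rcons s (proj_dart d).
Proof.
move=> ds rs; have := val_dtgt d; rewrite ds reduce_id // => dt.
rewrite /far !geodesic_base; case: d ds dt {rs} => a [] ds dt.
  have {}ds : val (cover_src a) = s := ds.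
  have {}dt : val (cover_tgt a) = rcons s (proj_dart (a, true)) := dt.
  by rewrite ds dt size_rcons ltnSn.
have {}ds : val (cover_tgt a) = s := ds.
have {}dt : val (cover_src a) = rcons s (proj_dart (a, false)) := dt.
by rewrite ds dt size_rcons ltnNge leqnSn.
Qed.

(* [gamma] is read off at a point where the loop [val w] crosses [e] along the
   axis of [w]; the powers of [w] push any vertex to the two ends of this axis. *)
Lemma axis_edge (e : edge g) w : T e -> belongs e w ->
  exists2 gamma, initial_word T gamma w &
    forall u, exists K, forall j, (K <= j)%N ->
      let a := deck_edge gamma (lift_edge T e) in
      side (cover_base x0) a (deck_vert (w ^+ j)%g u) /\
      side (cover_base x0) a (deck_vert (w^-1 ^+ j)%g u) = false.
Proof.
move=> Te ew; have rw := pi1_reduced w.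
have [b [k [wE ck]]] := cyclic_decomposition rw.
have [c [k1 [k2 kE]]] : exists c k1 k2, k = k1 ++ (e, c) :: k2.
  (* The core [k] is a cyclic reduction of [w], so it uses [e]. *)
  have : uses e k by apply: ew; split=> //; rewrite wE; exact: contract_conj.
  by case/orP=> /splitPr[k1 k2]; [exists true | exists false]; exists k1, k2.
have k0 : k != [::] by rewrite kE; case: (k1).
have wE' : val w = (b ++ k1) ++ ((e, c) :: k2 ++ walk_inv b).
  by rewrite wE kE -!catA.
have [gamma iw gE] := initial_word_prefix wE'; exists gamma => // u.
exists (size (val u)).+1 => j uj a; have [ww _] := pi1P w.
have ds : walk_end x0 (b ++ k1) = dsrc (e, c).
  by move: ww; rewrite wE' walk_cat /= => /and3P[_ /eqP-> _].
have r1 : reduced (rcons (b ++ k1) (e, c)).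
  move: rw; rewrite wE' -(cat1s (e, c)) (catA (b ++ k1)) => /reducedW[].
  by rewrite cats1.
have farE : far (cover_base x0) a = rcons (b ++ k1) (e, c).
  apply: (@far_base_dart (a, c)) => //=.
  by rewrite dsrc_deck dsrc_lift_edge // -ds gE.
have sideE v : side (cover_base x0) a v = prefix (rcons (b ++ k1) (e, c)) (val v).
  by rewrite /side farE geodesic_base.
have wiE : val (w^-1)%g = b ++ walk_inv k ++ walk_inv b.
  rewrite /= reduce_id; last exact: reduced_walk_inv.
  by rewrite wE !walk_inv_cat walk_invK catA.
rewrite !sideE; split.
  apply: prefix_trans (prefix_deck_exp wE k0 ck uj).
  by rewrite kE catA -cat_rcons prefix_prefix.
have ki0 : walk_inv k != [::] by rewrite -size_eq0 size_walk_inv size_eq0.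
(* The negative powers begin with [b ++ walk_inv k]. If [far] were also a prefix, [k] and
   [walk_inv k] would start with the same dart. *)
have := prefix_deck_exp wiE ki0 (cyclically_reduced_inv ck) uj.
move=> /prefixP[r ->]; apply/negP => /prefixP[r'].
rewrite -cats1 -!catA => /eqP; rewrite eqseq_cat // eqxx /= => /eqP krE.
case kc : (ohead k) => [d|]; last by case: (k) k0 kc.
apply: (cyclically_reduced_ends ck kc); move: ki0 krE kc; rewrite kE.
case: (walk_inv _) => // d' s' _; case: (k1) => [|d'' s''] /=.
  by case=> -> _ [->].
by case=> -> _ [->].
Qed.

End Labels.

(** * Separation by a translate of the edge *)

Section Separation.
Variables (g : graph) (x0 : vert g) (T : spanning_tree x0).
Implicit Types (u v : cover_vert x0) (a : cover_edge x0) (w : pi1 x0).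

Lemma cover_dart_inj (d d' : dart (ucover x0)) :
  @dsrc (ucover x0) d = @dsrc (ucover x0) d' -> proj_dart d = proj_dart d' ->
  d = d'.
Proof.
move=> ed ep; have et : @dtgt (ucover x0) d = @dtgt (ucover x0) d'.
  by apply: val_inj; rewrite !val_dtgt ed ep.
case: d d' ed ep et => a b [a' b'] ed /[dup] -[ea eb] ep et; subst b'.
congr pair; apply: cover_edge_inj => //; by case: b ed et {ep}.
Qed.

(** A dart of the cover is determined by its source and its projection, so the condition on [P] can
    be read on the projected geodesic. *)
Lemma geodesic_head_dart (e : edge g) (b : bool) w P : T e ->
  let X := lift_vert T (dsrc (e, b)) in
  @shortest_walk (ucover x0) X (deck_vert w X) P ->
  ~ begins_with P (lift_edge T e) ->
  ohead (geodesic X (deck_vert w X)) <> Some (e, b).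
Proof.
move=> Te X PX nP; rewrite -(shortest_walk_proj PX).
case: P PX nP => // d P [/= /andP[/eqP dX _] _ _] nP dE; apply: nP.
exists b, P; congr cons; apply: cover_dart_inj; first by rewrite dX dsrc_lift_edge.
by case: d dE {dX} => a c [<- <-].
Qed.

Lemma deck_edgeM w w' a : deck_edge (w * w')%g a = deck_edge w (deck_edge w' a).
Proof. by apply: cover_edge_inj => //; apply: deck_vertM. Qed.

Lemma geodesic_exp w u j : geodesic u (deck_vert (w ^+ j)%g u) =
  reduce (seq_pow j (geodesic u (deck_vert w u))).
Proof.
elim: j => [|j IHj]; first by rewrite deck_vert1 geodesic_id.
rewrite expgS deck_vertM -(geodesic_cat _ (deck_vert w u)) geodesic_deck IHj.
by rewrite reduce_catr.
Qed.

Lemma ohead_geodesic_exp w u j d : ohead (geodesic u (deck_vert w u)) <> Some d ->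
  ohead (geodesic u (deck_vert (w ^+ j)%g u)) <> Some d.
Proof.
case: j => [|j]; first by rewrite deck_vert1 geodesic_id.
by rewrite geodesic_exp ohead_reduce_pow // reduced_geodesic.
Qed.

(* The geodesic from [X1] to [w1^N X1] crosses the given translate of [e] but
   does not begin with [d], while the one from [X1] to [w2^M X2] begins with
   [d], so that it misses this translate. *)
Lemma separation (d : dart g) w1 w2 : T d.1 -> belongs d.1 w1 ->
  let X1 := lift_vert T (dsrc d) in let X2 := lift_vert T (dtgt d) in
  ohead (geodesic X1 (deck_vert w1 X1)) <> Some d ->
  ohead (geodesic X2 (deck_vert w2 X2)) <> Some (dinv d) ->
  exists2 gamma, initial_word T gamma w1 &
    exists K, forall p N M a, (K <= p)%N -> (K + p <= N)%N ->
      a = deck_edge (w1 ^+ p * gamma)%g (lift_edge T d.1) ->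
      side (cover_base x0) a (deck_vert (w1 ^+ N)%g X1) !=
      side (cover_base x0) a (deck_vert (w2 ^+ M)%g X2).
Proof.
move=> Td dw1 X1 X2 h1 h2; have [gamma iw H] := axis_edge Td dw1.
exists gamma => //; have {H} [K H] := H X1; exists K => p N M a Kp KN aE.
have s1 : side X1 a (deck_vert (w1 ^+ N)%g X1).
  (* Seen from the translate of the base by [w1 ^+ p], the edge is the one of [axis_edge], and the
     two vertices are the translates of [X1] by [w1 ^+ (N - p)] and [w1^-1 ^+ p]; both exponents are
     at least [K]. *)
  rewrite (side_cocycle (deck_vert (w1 ^+ p)%g (cover_base x0))).
  have Np : (K <= N - p)%N by lia.
  have -> : N = (p + (N - p))%N by lia.
  have {2}-> : X1 = deck_vert (w1 ^+ p)%g (deck_vert (w1^-1 ^+ p)%g X1).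
    by rewrite -deck_vertM expVgn mulgV deck_vert1.
  rewrite expgnDr deck_vertM aE deck_edgeM !side_deck.
  by rewrite (H _ Np).1 (H _ Kp).2.
have s2 : side X1 a (deck_vert (w2 ^+ M)%g X2) = false.
  have [b [fE _]] := farP X1 a; apply/negP; move: s1; rewrite /side fE.
  have hN := @ohead_geodesic_exp w1 X1 N d h1.
  have := @ohead_geodesic_exp w2 X2 M (dinv d) h2.
  rewrite -(geodesic_cat X1 X2 (deck_vert _ X2)) geodesic_lift_vert //.
  set c := rcons _ _ => hM.
  (* No cancellation occurs after [d], so this geodesic begins with [d]. A common nonempty prefix
     would force the geodesic to [w1 ^+ N] times [X1] to begin with [d] too. *)
  have -> : reduce ([:: d] ++ geodesic X2 (deck_vert (w2 ^+ M)%g X2)) =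
      d :: geodesic X2 (deck_vert (w2 ^+ M)%g X2).
    rewrite reduce_id //; move: hM (reduced_geodesic X2 (deck_vert (w2 ^+ M)%g X2)).
    case: geodesic => //= d' s hd; rewrite /reduced /= => ->; rewrite andbT.
    by apply/eqP => d'd; apply: hd; rewrite d'd.
  move: hN; case: geodesic => [|d' s]; rewrite /c; case: rcons (size_rcons
    (geodesic X1 (@dsrc (ucover x0) (a, b))) (proj_edge a, b)) => // x r _ hN.
  by move=> /andP[/eqP-> _] /andP[/eqP xd _]; apply: hN; rewrite /= xd.
have H1 := side_cocycle X1 (cover_base x0) a.
by rewrite !H1 s1 s2; case: side.
Qed.

End Separation.

(** * Continuous maps to a graph *)

Section Realization.
Variable R : realType.

(** Neighborhoods are generated by [realization_open] sets, so an open set is the union of those it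
    contains. *)
Lemma realization_openE (g : graph) (A : set (realization R g)) :
  open A <-> realization_open A.
Proof.
pose inner x := exists B, [/\ realization_open B, B x & B `<=` A].
have nbhs_inner x : nbhs x A <-> inner x by [].
rewrite openE; split=> [oA|oA x Ax]; last first.
  have Ai : inner x by exists A; split.
  exact: ((nbhs_inner x).2 Ai).
pose I := {B : set (realization R g) | realization_open B /\ B `<=` A}.
have AE : A = \bigcup_(i : I) sval i.
  rewrite eqEsubset; split=> [x Ax|x [[B [oB BA]] _]]; last exact: BA.
  have [B [oB Bx BA]] := (nbhs_inner x).1 (oA x Ax).
  by exists (exist _ B (conj oB BA)).
by rewrite AE; apply: realization_open_bigU => i; exact: (svalP i).1.
Qed.

Lemma edge_pt_continuous (g : graph) (e : edge g) :
  continuous (edge_pt e : R -> realization R g).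
Proof. by apply/continuousP => A /realization_openE; apply. Qed.

Lemma realization_continuous (g : graph) (Y : topologicalType)
    (h : realization R g -> Y) :
  (forall e, continuous (h \o edge_pt e)) -> continuous h.
Proof.
move=> hc; apply/continuousP => A oA; apply/realization_openE => e.
by have /continuousP := hc e; apply.
Qed.

Lemma edge_pt0 (g : graph) (e : edge g) : edge_pt e (0 : R) = inl (src e).
Proof. by rewrite /edge_pt insubN ?lexx // ltxx. Qed.

Lemma edge_pt1 (g : graph) (e : edge g) : edge_pt e (1 : R) = inl (tgt e).
Proof. by rewrite /edge_pt insubN ?ltxx ?andbF // ler10. Qed.

Section Height.
Variables (g : graph) (nu : vert g -> R).

Definition height (x : realization R g) : R :=
  match x with
  | inl v => nu v
  | inr (e, t) => nu (src e) + val t * (nu (tgt e) - nu (src e))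
  end.

(** Clamping [t] to the unit interval accounts for the constant extension of [edge_pt] and makes
    continuity on all of [R] visible. *)
Lemma height_edge_pt e (t : R) : height (edge_pt e t) =
  nu (src e) + Num.max 0 (Num.min t 1) * (nu (tgt e) - nu (src e)).
Proof.
rewrite /edge_pt; case: insubP => [u /andP[u0 u1] ut|] /=.
  by rewrite ut (min_idPl (ltW u1)) (max_idPr (ltW u0)).
rewrite negb_and -!leNgt; case: lerP => [t0 _|t0 /= t1].
  have t1 : t <= 1 by rewrite (le_trans t0).
  by rewrite (min_idPl t1) (max_idPl t0) mul0r addr0.
by rewrite (min_idPr t1) (max_idPr ler01) mul1r addrC subrK.
Qed.

Lemma height_continuous : continuous height.
Proof.
apply: realization_continuous => e.
have -> : height \o edge_pt e =
  fun t => nu (src e) + Num.max 0 (Num.min t 1) * (nu (tgt e) - nu (src e)).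
  by apply/funext => t; exact: height_edge_pt.
move=> t; apply: cvgD; first exact: cvg_cst.
apply: cvgMr_tmp.
have := @continuous_max R R (cst 0) (id \min cst 1) t.
apply; first exact: cst_continuous.
by apply: (@continuous_min R R id (cst 1)); [exact: cvg_id | exact: cst_continuous].
Qed.

End Height.

(* The heights are chosen so that the slab [0 <= height <= 1] is the edge [e]. *)
Lemma edge_crossing (g : graph) (e : edge g) (side : vert g -> bool)
    (h : R -> realization R g) u v :
  loopless g -> (forall a, side (tgt a) = side (src a) (+) (e == a)) ->
  continuous h -> h 0 = inl u -> h 1 = inl v -> side u != side v ->
  exists2 t, t \in `[0, 1] & h t = edge_pt e t.
Proof.
move=> gl se hc h0 h1 uv.
have seE : side (src e) = ~~ side (tgt e) by rewrite se eqxx addbT negbK.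
(* Any other edge has both ends on one side of [e], and they are distinct as there are no loops. So
   its end heights are 2 and 1 or 2, or -1 and 0 or -1, and its interior avoids the slab. *)
pose nu z : R := if z == src e then 0 else if z == tgt e then 1
  else if side z == side (tgt e) then 2 else -1.
have nu_near z : side z = side (tgt e) -> (z == tgt e) || (nu z == 2).
  rewrite /nu => sz; have [zs|_] := eqVneq z (src e).
    by move: sz; rewrite zs seE; case: (side _).
  by case: ifP => //= _; rewrite sz eqxx eqxx.
have nu_far z : side z != side (tgt e) -> (z == src e) || (nu z == -1).
  rewrite /nu => sz; have [//|_] := eqVneq z (src e).
  have [zs|_] := eqVneq z (tgt e); first by move: sz; rewrite zs eqxx.
  by rewrite (negPf sz) eqxx.
have nu_s : nu (src e) = 0 by rewrite /nu eqxx.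
have nu_t : nu (tgt e) = 1 by rewrite /nu eq_sym (negPf (gl e)) eqxx.
have slab x (t : R) : 0 <= t <= 1 -> height nu x = t -> x = edge_pt e t.
  case/andP=> {h0 h1} t0 t1; case: x => [z|[a s]] /=.
    have [sz|sz] := eqVneq (side z) (side (tgt e)).
      case/orP: (nu_near _ sz) => [/eqP->|/eqP->] zt.
        by rewrite -zt nu_t edge_pt1.
      by exfalso; lra.
    case/orP: (nu_far _ sz) => [/eqP->|/eqP->] zt.
      by rewrite -zt nu_s edge_pt0.
    by exfalso; lra.
  have /andP[s0 s1] := valP s; have [->|ae] := eqVneq a e.
    rewrite nu_s nu_t subr0 mulr1 add0r => <-.
    by rewrite /edge_pt valK.
  have sa : side (tgt a) = side (src a).
    by rewrite se eq_sym (negPf ae) addbF.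
  have gla := gl a; case: s s0 s1 => s s01 /= s0 s1.
  have [sz|sz] := eqVneq (side (src a)) (side (tgt e)).
    have nt : (tgt a == tgt e) || (nu (tgt a) == 2).
      by apply: nu_near; rewrite sa.
    case/orP: nt (nu_near _ sz) => /eqP at_ /orP[] /eqP as_.
    - by move: gla; rewrite at_ as_ eqxx.
    - by rewrite at_ as_ nu_t => ?; exfalso; lra.
    - by rewrite at_ as_ nu_t => ?; exfalso; lra.
    - by rewrite at_ as_ => ?; exfalso; lra.
  have nt : (tgt a == src e) || (nu (tgt a) == -1).
    by apply: nu_far; rewrite sa.
  case/orP: nt (nu_far _ sz) => /eqP at_ /orP[] /eqP as_.
  - by move: gla; rewrite at_ as_ eqxx.
  - by rewrite at_ as_ nu_s => ?; exfalso; lra.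
  - by rewrite at_ as_ nu_s => ?; exfalso; lra.
  - by rewrite at_ as_ => ?; exfalso; lra.
have nu_ge z : side z = side (tgt e) -> 1 <= nu z.
  by move/nu_near/orP => [] /eqP ->; rewrite ?nu_t // ler1n.
have nu_le z : side z != side (tgt e) -> nu z <= 0.
  by move/nu_far/orP => [] /eqP ->; rewrite ?nu_s // oppr_le0.
(* A zero of [phi] is a [t] at which [h t] has height [t], hence is the point of parameter [t] on
   [e]. Heights at least 1 on one side and at most 0 on the other give the signs at the two ends,
   whichever way the path crosses. *)
pose phi t : R := height nu (h t) - t.
have phic : {within `[0, 1], continuous phi}.
  apply: continuous_subspaceT => t; apply: cvgB; last exact: cvg_id.
  by apply: continuous_comp; [exact: hc | exact: height_continuous].
have [t t01 pt] : exists2 t, t \in `[0, 1] & phi t = 0.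
  apply: IVT phic _; first exact: ler01.
  rewrite /phi h0 h1 {h0 h1} /= subr0 ge_min le_max.
  have [su|su] := eqVneq (side u) (side (tgt e)).
    have := nu_ge _ su; have : nu v <= 0.
      by apply: nu_le; rewrite -su eq_sym.
    by move=> *; apply/andP; split; apply/orP; [right|left]; lra.
  have := nu_le _ su; have : 1 <= nu v.
    apply: nu_ge; move: uv su; case: (side u); case: (side v); by case: (side _).
  by move=> *; apply/andP; split; apply/orP; [left|right]; lra.
exists t => //; apply: slab; first by move: t01; rewrite in_itv.
by apply/eqP; rewrite -subr_eq0; apply/eqP.
Qed.

End Realization.

(** * Periodic points *)

Section PeriodicPoints.
Variables (R : realType) (g : graph) (x0 : vert g) (T : spanning_tree x0).
Variables (f : realization R g -> realization R g)
          (ft : realization R (ucover x0) -> realization R (ucover x0)).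
Implicit Types (w : pi1 x0) (y : realization R (ucover x0)) (d : dart g).

Lemma cover_loopless : loopless g -> loopless (ucover x0).
Proof.
move=> gl a; apply: contraNneq (gl (proj_edge a)) => /= e.
have := proj_dsrc (a, false : bool); have := proj_dsrc (a, true : bool).
by rewrite /dsrc /= => <- <-; rewrite e.
Qed.

Lemma deck_edge_pt w (a : cover_edge x0) (t : R) :
  deck w (@edge_pt R (ucover x0) a t) =
  edge_pt (deck_edge w a : edge (ucover x0)) t.
Proof.
rewrite /edge_pt; case: insubP => //= _.
by case: ifP => // _; rewrite cover_tgt_deck.
Qed.

(** At the terminal vertex this needs the lifted edge to end at the chosen lift, which holds for
    tree edges. *)
Lemma lift_edge_pt (e : edge g) (t : R) : T e ->
  lift_pt T (edge_pt e t) = edge_pt (lift_edge T e : edge (ucover x0)) t.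
Proof.
move=> Te; rewrite /edge_pt; case: insubP => //= _.
by case: ifP => // _; rewrite cover_tgt_lift_edge.
Qed.

Lemma deckM w w' y : deck (w * w')%g y = deck w (deck w' y).
Proof. by case: y => [v|[a t]] /=; rewrite ?deck_vertM ?deck_edgeM. Qed.

Lemma deck1 y : deck 1%g y = y.
Proof.
case: y => [v|[a t]] /=; first by rewrite deck_vert1.
by congr (inr (_, _)); apply: cover_edge_inj => //=; exact: deck_vert1.
Qed.

Lemma cover_proj_deck w y : cover_proj (deck w y) = cover_proj y.
Proof. by case: y => [v|[a t]] //=; rewrite proj_deck_vert. Qed.

Lemma cover_proj_lift_pt x : cover_proj (lift_pt T x) = x :> realization R g.
Proof.
case: x => [v|[e t]] //=; have [wv ev] := tree_walkP T v.
by rewrite /proj_vert /= walk_end_reduce // ev.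
Qed.

Hypothesis ft_lift : equivariant_lift f ft.

Lemma iter_lift k y : cover_proj (iter k ft y) = iter k f (cover_proj y).
Proof. by case: ft_lift => _ fp _; elim: k => //= k <-. Qed.

Lemma iter_deck k w y : iter k ft (deck w y) = deck w (iter k ft y).
Proof. by case: ft_lift => _ _ fd; elim: k => //= k ->. Qed.

Lemma iter_deck_exp k w j y : iter k ft y = deck w y ->
  iter (j * k) ft y = deck (w ^+ j)%g y.
Proof.
move=> ky; elim: j => [|j IHj]; first by rewrite deck1.
by rewrite mulSn iterD IHj iter_deck ky -deckM -expgSr.
Qed.

Lemma iter_continuous k : continuous (iter k ft).
Proof.
case: ft_lift => fc _ _; elim: k => [|k IHk] y; first exact: cvg_id.
by apply: continuous_comp; [exact: IHk | exact: fc].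
Qed.

(** A crossing of the translate [a] at equal parameters says that [ft^q] moves the lifted point by
    [w]; projecting makes the point fixed by [f^q]. *)
Lemma edge_rotation (e : edge g) q w u v : loopless g -> T e -> (0 < q)%N ->
  iter q ft (inl (lift_vert T (src e))) = inl u ->
  iter q ft (inl (lift_vert T (tgt e))) = inl v ->
  let a := deck_edge w (lift_edge T e) in
  side (cover_base x0) a u != side (cover_base x0) a v ->
  exists2 x, closed_edge e x & has_rotation_element T f ft x (w, q).
Proof.
move=> gl Te q0 qu qv a auv.
pose h (t : R) := iter q ft (edge_pt (lift_edge T e : edge (ucover x0)) t).
have hc : continuous h.
  move=> t; apply: (@continuous_comp _ _ _ (edge_pt _) (iter q ft)).
    exact: edge_pt_continuous.
  exact: iter_continuous.
have h0 : h 0 = inl u by rewrite /h edge_pt0.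
have h1 : h 1 = inl v by rewrite /h edge_pt1 /= cover_tgt_lift_edge.
have [t t01 ht] := @edge_crossing R (ucover x0) a (side (cover_base x0) a) h u v
  (cover_loopless gl) (side_edge _ a) hc h0 h1 auv.
have qt : iter q ft (lift_pt T (edge_pt e t)) = deck w (lift_pt T (edge_pt e t)).
  by rewrite lift_edge_pt // deck_edge_pt -ht.
exists (edge_pt e t); first by exists t.
exists q, w; split=> //; split=> //.
by rewrite -[X in iter q f X]cover_proj_lift_pt -iter_lift qt cover_proj_deck
  cover_proj_lift_pt.
Qed.

(** Formulated for a dart so that the reversed edge, which exchanges [w1] and [w2], yields the
    second family of points. *)
Lemma dart_rotation d m n w1 w2 P1 P2 : loopless g -> T d.1 -> belongs d.1 w1 ->
  rotates_by T f ft (vpt R (dsrc d)) m w1 ->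
  rotates_by T f ft (vpt R (dtgt d)) n w2 ->
  shortest_walk (g := ucover x0) (lift_vert T (dsrc d))
    (deck_vert w1 (lift_vert T (dsrc d))) P1 ->
  shortest_walk (g := ucover x0) (lift_vert T (dtgt d))
    (deck_vert w2 (lift_vert T (dtgt d))) P2 ->
  ~ begins_with P1 (lift_edge T d.1) -> ~ begins_with P2 (lift_edge T d.1) ->
  exists2 gamma, initial_word T gamma w1 &
    forall r : rat, 0 < r < 1 / m%:R -> exists p q : nat,
      [/\ (0 < q)%N, r = p%:R / q%:R & exists2 x, closed_edge d.1 x &
        has_rotation_element T f ft x (w1 ^+ p * gamma, q)%g].
Proof.
move=> gl Td dw1 [m0 _ r1] [n0 _ r2] P1s P2s P1d P2d.
have h1 : ohead (geodesic (lift_vert T (dsrc d))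
    (deck_vert w1 (lift_vert T (dsrc d)))) <> Some d.
  case: (d) Td P1s P1d => e b Te P1s P1d.
  exact: geodesic_head_dart P1s P1d.
have h2 : ohead (geodesic (lift_vert T (dtgt d))
    (deck_vert w2 (lift_vert T (dtgt d)))) <> Some (dinv d).
  rewrite -dsrc_inv in P2s *; case: (d) Td P2s P2d => e b Te P2s P2d.
  exact: geodesic_head_dart P2s P2d.
have [gamma iw [K sK]] := separation Td dw1 h1 h2.
exists gamma => // r /andP[r0 rm].
pose a := `|numq r|%N; pose b := `|denq r|%N.
have b0 : (0 < b)%N by rewrite absz_gt0 denq_neq0.
have a0 : (0 < a)%N by rewrite absz_gt0 numq_eq0 gt_eqF.
have rE : r = a%:R / b%:R.
  rewrite -[LHS]divq_num_den /a /b; congr (_ / _).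
    by rewrite -[in LHS](gez0_abs (_ : 0 <= numq r)) // numq_ge0 ltW.
  by rewrite -[in LHS](gez0_abs (_ : 0 <= denq r)) // denq_ge0.
have ab : (m * a < b)%N.
  move: rm; rewrite rE ltr_pdivrMr ?ltr0n // mulrAC mul1r.
  by rewrite ltr_pdivlMr ?ltr0n // -natrM ltr_nat mulnC.
(* With [p = c * m * a] and [q = c * m * b], the exponents are [N = q / m = c * b] and
   [M = q / n = K.+1 * m * b]. Since [m * a < b], both [p] and [N - p] are at least [c], hence
   exceed [K]. *)
pose c := (K.+1 * n)%N; exists (c * m * a)%N, (c * m * b)%N; split.
- by rewrite !muln_gt0 m0 n0 b0.
- rewrite rE !natrM -mulf_div divff ?mul1r // -!natrM.
  by rewrite pnatr_eq0 -lt0n !muln_gt0 m0 n0.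
have := sK (c * m * a)%N (c * b)%N (K.+1 * m * b)%N _ _ _ erefl.
have -> : (c * m * b)%N = (c * b * m)%N by rewrite mulnAC.
have e1 := iter_deck_exp (c * b) r1.
have e2 := iter_deck_exp (K.+1 * m * b) r2.
have nE : (K.+1 * m * b * n = c * b * m)%N by rewrite /c; nia.
have K1 : (K <= c * m * a)%N by rewrite /c; nia.
have K2 : (K + c * m * a <= c * b)%N by rewrite /c; nia.
move=> /(_ K1 K2) sep; rewrite nE in e2.
case: d Td {dw1 P1s P2s P1d P2d h1 h2 sK r1 r2} e1 e2 sep => e [] Te e1 e2 sep.
  apply: edge_rotation e1 e2 sep => //.
  by rewrite !muln_gt0 m0 n0 b0.
(* For the reversed dart the source of the edge is [dtgt d], so the two images trade places. *)
apply: edge_rotation e2 e1 _ => //; last by rewrite eq_sym.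
by rewrite !muln_gt0 m0 n0 b0.
Qed.

End PeriodicPoints.

Theorem theorem25 (R : realType) (G : fingraph) (x0 : vert G)
  (T : spanning_tree x0)
  (f : realization R G -> realization R G)
  (ft : realization R (ucover x0) -> realization R (ucover x0))
  (E : edge G) (V1 V2 : vert G) (m n : nat) (w1 w2 : pi1 x0)
  (P1 P2 : seq (dart (ucover x0)))
  (G_loopless : loopless G)
  (G_connected : connected_graph G)
  (f_continuous : continuous f)
  (f_vertex_map : vertex_map f)
  (f_homotopic : homotopic R f idfun)
  (ft_lift : equivariant_lift f ft)
  (E_src : src E = V1) (E_tgt : tgt E = V2)
  (E_tree : T E)
  (V1_rotation : rotates_by T f ft (vpt R V1) m w1)
  (V2_rotation : rotates_by T f ft (vpt R V2) n w2)
  (P1_shortest : shortest_walk (g := ucover x0)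
     (lift_vert T V1) (deck_vert w1 (lift_vert T V1)) P1)
  (P2_shortest : shortest_walk (g := ucover x0)
     (lift_vert T V2) (deck_vert w2 (lift_vert T V2)) P2)
  (E_w1 : belongs E w1) (E_w2 : belongs E w2)
  (P1_E : ~ begins_with P1 (lift_edge T E))
  (P2_E : ~ begins_with P2 (lift_edge T E)) :
  exists gamma1 gamma2 : pi1 x0,
    [/\ initial_word T gamma1 w1, initial_word T gamma2 w2 &
      forall r s : rat, 0 < r < 1 / m%:R -> 0 < s < 1 / n%:R ->
      exists p q p' q' : nat,
        [/\ (0 < q)%N /\ r = p%:R / q%:R,
            (0 < q')%N /\ s = p'%:R / q'%:R,
            exists2 x, closed_edge E x &
              has_rotation_element T f ft x (w1 ^+ p * gamma1, q)%g &
            exists2 x, closed_edge E x &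
              has_rotation_element T f ft x (w2 ^+ p' * gamma2, q')%g]].
Proof.
subst V1 V2.
have [gamma1 i1 H1] := dart_rotation (d := (E, true)) ft_lift G_loopless
  E_tree E_w1 V1_rotation V2_rotation P1_shortest P2_shortest P1_E P2_E.
have [gamma2 i2 H2] := dart_rotation (d := (E, false)) ft_lift G_loopless
  E_tree E_w2 V2_rotation V1_rotation P2_shortest P1_shortest P2_E P1_E.
exists gamma1, gamma2; split=> // r s /H1[p [q [q0 rE rp]]] /H2[p' [q' [q'0 sE sp]]].
by exists p, q, p', q'.
Qed.
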